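(* Let $M_k:\mathbb{R}^S\to\mathbb{R}^{m_k\times m_{k+1}}$, $k=1,\dots,K$, be linear maps, with $m_1=m$ and $m_{K+1}=n$. The map $(\mathbf{h}_1,\dots,\mathbf{h}_K)\mapsto M_1(\mathbf{h}_1)M_2(\mathbf{h}_2)\cdots M_K(\mathbf{h}_K)$ uniquely determines a linear map $\mathcal{A}:\mathbb{R}^{S^K}\to\mathbb{R}^{m\times n}$ such that for all $\mathbf{h}\in\mathbb{R}^{S\times K}$ $$M_1(\mathbf{h}_1)M_2(\mathbf{h}_2)\cdots M_K(\mathbf{h}_K)=\mathcal{A}P(\mathbf{h});$$ that is, there exists exactly one linear map $\mathcal{A}$ with this property.
   Context: $K\geq 1$, $S\geq 2$ and $m_1,\dots,m_{K+1}$ are positive integers, $[S]=\{1,\dots,S\}$. An element $\mathbf{h}\in\mathbb{R}^{S\times K}$ is a $K$-tuple of vectors $\mathbf{h}_1,\dots,\mathbf{h}_K\in\mathbb{R}^S$ with entries $\mathbf{h}_{k,i}$. $\mathbb{R}^{S^K}$ is the space of real order-$K$ tensors $T=(T_{\mathbf{i}})_{\mathbf{i}\in[S]^K}$. The Segre embedding is $P:\mathbb{R}^{S\times K}\to\mathbb{R}^{S^K}$, $P(\mathbf{h})_{\mathbf{i}}=\mathbf{h}_{1,i_1}\mathbf{h}_{2,i_2}\cdots\mathbf{h}_{K,i_K}$ for $\mathbf{i}=(i_1,\dots,i_K)\in[S]^K$. *)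

(* Defs.v *)
From mathcomp Require Import all_boot all_order all_algebra.
From mathcomp Require Import reals.

Set Implicit Arguments.
Unset Strict Implicit.
Unset Printing Implicit Defensive.

Import GRing.Theory.
Local Open Scope ring_scope.

(* Indices are 0-based: k : 'I_K and i : 'I_S stand for k + 1 and i + 1 in the
   usual 1-based notation. *)

(* The regular module R^o (instead of R) is what makes the function space a
   vector space over R. *)
Notation tensor R S K := {ffun {ffun 'I_K -> 'I_S} -> R^o}.

(* The k-th vector of the tuple h is col k h, whose i-th entry is h i k. *)
Definition segre (R : realType) (S K : nat) (h : 'M[R]_(S, K)) :
    tensor R S K :=
  [ffun i : {ffun 'I_K -> 'I_S} => \prod_(k < K) h (i k) k].

(* A_0 *m A_1 *m ... *m A_(K-1); only the values m 0, ..., m K matter. *)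
Fixpoint mxchain (R : realType) (m : nat -> nat) (K : nat) :
    (forall k : 'I_K, 'M[R]_(m k, m k.+1)) -> 'M[R]_(m 0%N, m K) :=
  match K with
  | 0 => fun _ => 1%:M
  | K'.+1 => fun A =>
      @mxchain R m K' (fun k => A (widen_ord (leqnSn K') k)) *m A ord_max
  end.

(* Main.v *)
Require Import Defs.
From HB Require Import structures.
From mathcomp Require Import all_boot all_order all_algebra.
From mathcomp Require Import reals.

(** Expanding each [h_k] in the canonical basis and using multilinearity of the
    matrix product gives existence. The map is unique because the canonical
    basis of the tensor space consists of the rank-one tensors [segre h] with
    all columns of [h] canonical basis vectors. *)

Set Implicit Arguments.
Unset Strict Implicit.
Unset Printing Implicit Defensive.

Import GRing.Theory.
Local Open Scope ring_scope.

Lemma eq_mxchain (R : realType) (m : nat -> nat) (K : nat)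
    (A B : forall k : 'I_K, 'M[R]_(m k, m k.+1)) :
  (forall k, A k = B k) -> mxchain A = mxchain B.
Proof.
elim: K A B => [//|K IHK] A B eqAB /=.
by rewrite eqAB; congr (_ *m _); apply: IHK => k; exact: (eqAB (widen_ord _ k)).
Qed.

(** The argument is a single pair so that this map is itself a bijection, ready for reindexing a sum
    over multi-indices of length [K.+1]. *)
Definition ffun_rcons (T : Type) (K : nat) (p : {ffun 'I_K -> T} * T) :
    {ffun 'I_K.+1 -> T} :=
  [ffun k => if unlift ord_max k is Some k' then p.1 k' else p.2].

Lemma ffun_rcons_widen (T : Type) (K : nat) (p : {ffun 'I_K -> T} * T) k :
  ffun_rcons p (widen_ord (leqnSn K) k) = p.1 k.
Proof.
have -> : widen_ord (leqnSn K) k = lift ord_max k.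
  by apply: ord_inj; rewrite lift_max.
by rewrite ffunE liftK.
Qed.

Lemma ffun_rcons_max (T : Type) (K : nat) (p : {ffun 'I_K -> T} * T) :
  ffun_rcons p ord_max = p.2.
Proof. by rewrite ffunE unlift_none. Qed.

Lemma ffun_rcons_bij (T : Type) (K : nat) : bijective (@ffun_rcons T K).
Proof.
exists (fun g : {ffun 'I_K.+1 -> T} =>
  ([ffun k : 'I_K => g (lift ord_max k)], g ord_max)).
  move=> [f j]; rewrite ffun_rcons_max; congr (_, _).
  by apply/ffunP => k; rewrite !ffunE liftK.
move=> g; apply/ffunP => k; rewrite ffunE.
by case: unliftP => [k'|] -> //=; rewrite ffunE.
Qed.

(** Multilinearity of the matrix product, by induction on [K]: the last factor is split off and
    distributed over the expansion of the others. *)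
Lemma mxchain_sum (R : realType) (m : nat -> nat) (K S : nat)
    (c : 'I_S -> 'I_K -> R)
    (B : forall k : 'I_K, 'I_S -> 'M[R]_(m k, m k.+1)) :
  mxchain (fun k => \sum_j c j k *: B k j) =
  \sum_(f : {ffun 'I_K -> 'I_S})
     (\prod_k c (f k) k) *: mxchain (fun k => B k (f k)).
Proof.
elim: K c B => [|K IHK] c B /=.
  (* For [K = 0] there is exactly one multi-index, so the sum is a single identity matrix. *)
  under eq_bigr do rewrite big_ord0 scale1r.
  by rewrite sumr_const card_ffun !card_ord expn0.
rewrite (IHK (fun j k => c j (widen_ord (leqnSn K) k))
             (fun k => B (widen_ord (leqnSn K) k))).
rewrite (reindex (@ffun_rcons 'I_S K)) /=; last exact/onW_bij/ffun_rcons_bij.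
(* The sum over pairs becomes a double sum, to be matched with the distributed product term by
   term. *)
rewrite mulmx_suml -(pair_big xpredT xpredT (fun f j =>
  (\prod_k c (ffun_rcons (f, j) k) k) *: (mxchain (fun k =>
     B (widen_ord (leqnSn K) k)
       (ffun_rcons (f, j) (widen_ord (leqnSn K) k)))
     *m B ord_max (ffun_rcons (f, j) ord_max)))) /=.
apply: eq_bigr => f _; rewrite mulmx_sumr; apply: eq_bigr => j _.
rewrite big_ord_recr /= ffun_rcons_max /= -scalemxAl -scalemxAr scalerA.
congr (_ *: _).
  by congr (_ * _); apply: eq_bigr => k _; rewrite ffun_rcons_widen.
by congr (_ *m _); apply: eq_mxchain => k; rewrite ffun_rcons_widen.
Qed.

(** A product of Kronecker deltas vanishes as soon as one coordinate of [g] differs from that of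
    [f]. *)
Lemma segre_basis (R : realType) (S K : nat) (f : {ffun 'I_K -> 'I_S}) :
  segre (\matrix_(i, k) (i == f k)%:R) = [ffun g => (g == f)%:R] :> tensor R S K.
Proof.
apply/ffunP => g; rewrite !ffunE; under eq_bigr do rewrite mxE.
have [->|/eqP neq_gf] := eqVneq g f; first by rewrite big1 // => k _; rewrite eqxx.
have [k neq_k] : exists k, g k != f k.
  by apply/existsP; rewrite -negb_forall; apply/negP => /forallP e; apply: neq_gf;
     apply/ffunP => k; apply/eqP/e.
by rewrite (bigD1 k) //= (negPf neq_k) mul0r.
Qed.

(** Hence a linear map on tensors is determined by its values on the image of [segre]. *)
Lemma tensor_segre_sum (R : realType) (S K : nat) (T : tensor R S K) :
  T = \sum_f T f *: segre (\matrix_(i, k) (i == f k)%:R).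
Proof.
apply/ffunP => g; rewrite sum_ffunE (bigD1 g) //= segre_basis !ffunE eqxx.
rewrite big1 ?addr0 => [|f neq_fg]; first by rewrite /GRing.scale /= mulr1.
by rewrite segre_basis !ffunE eq_sym (negPf neq_fg) scaler0.
Qed.

Lemma cV_sum_delta (R : nzRingType) (S : nat) (v : 'cV[R]_S) :
  v = \sum_j v j 0 *: delta_mx j 0.
Proof. by rewrite {1}[v]matrix_sum_delta; apply: eq_bigr => j _; rewrite big_ord1. Qed.

Theorem corollary5p2 (R : realType) (K S : nat) (m : nat -> nat)
    (hK : (1 <= K)%N) (hS : (2 <= S)%N)
    (hm : forall k : nat, (k <= K)%N -> (0 < m k)%N)
    (M : forall k : 'I_K, 'Hom('cV[R]_S, 'M[R]_(m k, m k.+1))) :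
  exists! A : 'Hom(tensor R S K, 'M[R]_(m 0%N, m K)),
    forall h : 'M[R]_(S, K),
      mxchain (fun k : 'I_K => M k (col k h)) = A (segre h).
Proof.
(* [C f] is the value forced on the basis tensor of index [f]; [a] is its linear extension. *)
pose C (f : {ffun 'I_K -> 'I_S}) := mxchain (fun k => M k (delta_mx (f k) 0)).
pose a (T : tensor R S K) : 'M[R]_(m 0%N, m K) := \sum_f (T f : R) *: C f.
have a_lin : linear a.
  move=> t T U; rewrite /a scaler_sumr -big_split; apply: eq_bigr => f _ /=.
  by rewrite !ffunE scalerDl scalerA.
pose aL := GRing.isLinear.Build _ _ _ _ a a_lin.
pose al : {linear tensor R S K -> 'M[R]_(m 0%N, m K)} := HB.pack a aL.
exists (linfun al); split=> [h|A' hA'].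
  rewrite lfunE /= /a.
  under eq_bigr do rewrite ffunE.
  (* The entries of [segre h] are exactly the coefficients produced by expanding every column of [h]
     in the canonical basis. *)
  rewrite -(mxchain_sum (fun i k => h i k) (fun k j => M k (delta_mx j 0))).
  apply: eq_mxchain => k; rewrite [col k h]cV_sum_delta linear_sum.
  by apply: eq_bigr => j _; rewrite linearZ mxE.
apply/lfunP => T; rewrite [T]tensor_segre_sum !linear_sum.
apply: eq_bigr => f _; rewrite !linearZ /= -hA'; congr (_ *: _).
(* On a basis tensor only the term [C f] survives in the sum defining [a]. *)
rewrite (lfunE al) /= /a segre_basis (bigD1 f) //= ffunE eqxx scale1r.
rewrite big1 ?addr0 => [|g neq_gf]; last by rewrite ffunE (negPf neq_gf) scale0r.
apply: eq_mxchain => k; congr (M k _).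
by apply/matrixP => i j; rewrite !mxE ord1 eqxx andbT.
Qed.
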